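(* For all $N\in\mathbb{N}$ the process $\mathbb{G}^{(N)}(\mathcal{F})=\{\mathbb{G}^{(N)}(f):f\in\mathcal{F}\}$ is Gaussian, centered and linear, with covariance function given, for $(f,g)\in\mathcal{F}^2$, by $$\mathrm{Cov}\left(\mathbb{G}^{(N)}(f),\mathbb{G}^{(N)}(g)\right)=\mathrm{Cov}\left(\mathbb{G}(f),\mathbb{G}(g)\right)-\sum_{k=1}^N\Phi_k^{(N)}(f)^t\cdot\mathbb{V}\left(\mathbb{G}[\mathcal{A}^{(k)}]\right)\cdot\Phi_k^{(N)}(g).$$
   Context: $\mathbb{N}=\{0,1,\dots\}$, $\mathbb{N}_*=\{1,2,\dots\}$. $P$ is a probability measure on $(\mathcal{X},\mathcal{A})$, $P(f)=\int f\,dP$. For each $N\in\mathbb{N}_*$, $\mathcal{A}^{(N)}=\{A_1^{(N)},\dots,A_{m_N}^{(N)}\}\subset\mathcal{A}$ is a finite partition of $\mathcal{X}$ with $m_N\geqslant2$ and $\min_jP(A_j^{(N)})>0$; consecutive partitions are different. $\mathcal{F}$ is a class of measurable real functions, uniformly bounded by $M<\infty$, pointwise measurable (each $f\in\mathcal{F}$ is a pointwise limit of a sequence from a fixed countable subset of $\mathcal{F}$), containing $1_A$ and $1_Af$ for $f\in\mathcal{F}$ and $A$ in the partitions $\mathcal{A}^{(k)}$, $1\leqslant k\leqslant N$, and satisfying one of the following entropy conditions, with $d_Q^2(f,g)=\int(f-g)^2dQ$: (VC) for some $c_0,\nu_0>0$ the minimal number of $d_Q$-balls of radius $\varepsilon$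 covering $\mathcal{F}$ is at most $c_0/\varepsilon^{\nu_0}$ for all $0<\varepsilon<1$ and all discrete probability measures $Q$; (BR) for some $b_0>0,r_0\in(0,1)$ the minimal number of brackets $\{f:g_-\leqslant f\leqslant g_+\}$ with $d_P(g_-,g_+)<\varepsilon$ covering $\mathcal{F}$ is at most $\exp(b_0^2/\varepsilon^{2r_0})$ for $0<\varepsilon<1$. $\mathbb{G}=\mathbb{G}^{(0)}$ is the $P$-Brownian bridge indexed by $\mathcal{F}$: centered Gaussian, linear in $f$, $\mathrm{Cov}(\mathbb{G}(f),\mathbb{G}(g))=P(fg)-P(f)P(g)$. Write $\mathbb{G}^{(N)}(A)=\mathbb{G}^{(N)}(1_A)$ and $\mathbb{E}(f|A)=P(f1_A)/P(A)$. For $N\in\mathbb{N}_*$, $$\mathbb{G}^{(N)}(f)=\mathbb{G}^{(N-1)}(f)-\sum_{j=1}^{m_N}\mathbb{E}(f|A_j^{(N)})\,\mathbb{G}^{(N-1)}(A_j^{(N)}).$$ Column vectors: $\mathbb{E}[f|\mathcal{A}^{(k)}]=(\mathbb{E}(f|A_1^{(k)}),\dots,\mathbb{E}(f|A_{m_k}^{(k)}))^t$, $\mathbb{G}[\mathcal{A}^{(k)}]=(\mathbb{G}(A_1^{(k)}),\dots,\mathbb{G}(A_{m_k}^{(k)}))^t$; $\mathbb{V}(\mathbb{G}[\mathcal{A}^{(k)}])$ is the covariance matrix of the latter, i.e. $\mathrm{diag}(P(A_j^{(k)}))-(P(A_i^{(k)})P(A_j^{(k)}))_{i,j}$. $\mathbf{P}_{\mathcal{A}^{(k)}|\mathcal{A}^{(l)}}$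 is the $m_l\times m_k$ matrix with entries $P(A_j^{(k)}\cap A_i^{(l)})/P(A_i^{(l)})$, $1\leqslant i\leqslant m_l$, $1\leqslant j\leqslant m_k$. For $1\leqslant k\leqslant N$, $$\Phi_k^{(N)}(f)=\mathbb{E}[f|\mathcal{A}^{(k)}]+\sum_{\substack{1\leqslant L\leqslant N-k\\ k<l_1<\dots<l_L\leqslant N}}(-1)^L\,\mathbf{P}_{\mathcal{A}^{(l_1)}|\mathcal{A}^{(k)}}\mathbf{P}_{\mathcal{A}^{(l_2)}|\mathcal{A}^{(l_1)}}\cdots\mathbf{P}_{\mathcal{A}^{(l_L)}|\mathcal{A}^{(l_{L-1})}}\cdot\mathbb{E}[f|\mathcal{A}^{(l_L)}].$$ *)

(* Defs.v *)
From HB Require Import structures.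
From mathcomp Require Import all_boot all_order all_algebra.
From mathcomp Require Import all_classical all_reals all_analysis.

Set Implicit Arguments.
Unset Strict Implicit.
Unset Printing Implicit Defensive.

Import Order.TTheory GRing.Theory Num.Theory.
Import numFieldNormedType.Exports.

Local Open Scope classical_set_scope.
Local Open Scope ring_scope.

(** * Function classes and entropy *)

Section FunctionClass.
Context {d : measure_display} {X : measurableType d} {R : realType}.
Implicit Types (F : set (X -> R)) (P Q : probability X R) (f g : X -> R).

(* [d_Q], with values in [0, +oo]. *)
Definition L2dist Q f g : \bar R := sqrte (\int[Q]_x ((f x - g x) ^+ 2)%:E)%E.

(* Purely atomic, with at most countably many atoms; the weights sum to 1
   because [Q] is a probability. *)
Definition discrete_probability Q : Prop :=
  exists (x : nat -> X) (w : nat -> R), (forall i, 0 <= w i) /\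
    forall B, measurable B ->
      Q B = (\sum_(0 <= i <oo) ((w i)%:E * \d_(x i) B))%E.

(* The centers of the balls need not lie in [F]. *)
Definition ball_cover Q F (e : R) (n : nat) : Prop :=
  exists c : 'I_n -> X -> R, (forall i, measurable_fun setT (c i)) /\
    forall f, F f -> exists i, (L2dist Q f (c i) < e%:E)%E.

(* The infimum over the empty set is [+oo]. *)
Definition covering_number Q F (e : R) : \bar R :=
  ereal_inf [set n%:R%:E | n in [set n : nat | ball_cover Q F e n]].

(* The end points of the brackets need not lie in [F]. *)
Definition bracket_cover P F (e : R) (n : nat) : Prop :=
  exists lo hi : 'I_n -> X -> R,
    (forall i, [/\ measurable_fun setT (lo i), measurable_fun setT (hi i)
                 & (L2dist P (lo i) (hi i) < e%:E)%E]) /\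
    forall f, F f -> exists i, forall x, lo i x <= f x <= hi i x.

Definition bracketing_number P F (e : R) : \bar R :=
  ereal_inf [set n%:R%:E | n in [set n : nat | bracket_cover P F e n]].

Definition VC_entropy F : Prop :=
  exists c0 nu0 : R, [/\ 0 < c0, 0 < nu0 &
    forall e : R, 0 < e < 1 -> forall Q, discrete_probability Q ->
      (covering_number Q F e <= (c0 / e `^ nu0)%:E)%E].

Definition BR_entropy P F : Prop :=
  exists b0 r0 : R, [/\ 0 < b0, 0 < r0 < 1 &
    forall e : R, 0 < e < 1 ->
      (bracketing_number P F e <= (expR (b0 ^+ 2 / e `^ (2 * r0)))%:E)%E].

Definition uniformly_bounded F : Prop :=
  exists M : R, forall f, F f -> forall x, `|f x| <= M.

Definition pointwise_measurable F : Prop :=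
  exists F0 : set (X -> R), [/\ countable F0, F0 `<=` F &
    forall f, F f -> exists h : nat -> X -> R,
      (forall n, F0 (h n)) /\ forall x, h n x @[n --> \oo] --> f x].

End FunctionClass.

(** * Gaussian processes *)

Section GaussianProcess.
Context {d : measure_display} {Om : measurableType d} {R : realType}.
Variable Pr : probability Om R.

(* Degenerate (constant) variables count as Gaussian; they need a separate case
   since [normal_prob m 0] is a uniform law. *)
Definition gaussian_variable (Y : Om -> R) : Prop :=
  measurable_fun setT Y /\
  exists m s : R, 0 <= s /\ forall B : set R, measurable B ->
    Pr (Y @^-1` B) = if s == 0 then \d_m B else normal_prob m s B.

(* Every finite-dimensional marginal is a Gaussian vector, that is, all the
   linear combinations of its coordinates are Gaussian. *)
Definition gaussian_process {I : Type} (F : set I) (G : I -> Om -> R) : Prop :=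
  forall (n : nat) (f : 'I_n -> I) (a : 'I_n -> R), (forall i, F (f i)) ->
    gaussian_variable (fun w => \sum_(i < n) a i * G (f i) w).

Definition centered_process {I : Type} (F : set I) (G : I -> Om -> R) : Prop :=
  forall f, F f -> ('E_Pr[G f] = 0)%E.

(* The index set need not be a vector space, so arbitrary finite linear
   combinations are considered, whenever they lie in [F]; as usual for
   processes, the equality is between random variables up to null sets. *)
Definition linear_process {X : Type} (F : set (X -> R))
    (G : (X -> R) -> Om -> R) : Prop :=
  forall (n : nat) (f : 'I_n -> X -> R) (a : 'I_n -> R),
    (forall i, F (f i)) -> F (fun x => \sum_(i < n) a i * f i x) ->
    {ae Pr, forall w,
      G (fun x => \sum_(i < n) a i * f i x) w = \sum_(i < n) a i * G (f i) w}.

Definition brownian_bridge {d' : measure_display} {X : measurableType d'}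
    (P : probability X R) (F : set (X -> R)) (G : (X -> R) -> Om -> R) : Prop :=
  [/\ gaussian_process F G, centered_process F G, linear_process F G &
    forall f g, F f -> F g -> covariance Pr (G f) (G g) =
      (\int[P]_x (f x * g x) - (\int[P]_x f x) * (\int[P]_x g x))%:E].

End GaussianProcess.

(** * Raking along a sequence of partitions *)

Section Raking.
Context {d : measure_display} {X : measurableType d} {R : realType}.
Variables (P : probability X R) (m : nat -> nat).
(* The partitions are numbered from 1; the value at 0 is not used. *)
Variable A : forall k, 'I_(m k) -> set X.

Definition partition_sequence : Prop :=
  [/\ forall k, (1 <= k)%N -> (2 <= m k)%N,
      forall k, (1 <= k)%N -> partition [set: 'I_(m k)] (@A k) [set: X],
      forall k, (1 <= k)%N -> forall j, measurable (@A k j),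
      forall k, (1 <= k)%N -> forall j, (0 < P (@A k j))%E
    & forall k, (1 <= k)%N -> range (@A k) <> range (@A k.+1)].

Definition closed_under_cells (F : set (X -> R)) (N : nat) : Prop :=
  forall k, (1 <= k <= N)%N -> forall j : 'I_(m k),
    F \1_(@A k j) /\ forall f, F f -> F (fun x => \1_(@A k j) x * f x).

Definition cond_mean (f : X -> R) (B : set X) : R :=
  (\int[P]_x (f x * \1_B x)) / fine (P B).

Definition raked {Om : Type} (G : (X -> R) -> Om -> R) :
    nat -> (X -> R) -> Om -> R :=
  fix GN N f w := match N with
    | 0 => G f w
    | N'.+1 => GN N' f w -
        \sum_(j < m N'.+1) cond_mean f (@A N'.+1 j) * GN N' \1_(@A N'.+1 j) w
    end.

Definition cond_mean_col (f : X -> R) (k : nat) : 'cV[R]_(m k) :=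
  \col_j cond_mean f (@A k j).

Definition cell_cov {d' : measure_display} {Om : measurableType d'}
    (Pr : probability Om R) (G : (X -> R) -> Om -> R) (k : nat) : 'M[R]_(m k) :=
  \matrix_(i, j) fine (covariance Pr (G \1_(@A k i)) (G \1_(@A k j))).

(* [trans_mx k l] is P_{A^(k) | A^(l)}, of size m_l x m_k. *)
Definition trans_mx (k l : nat) : 'M[R]_(m l, m k) :=
  \matrix_(i, j) (fine (P (@A k j `&` @A l i)) / fine (P (@A l i))).

(* For [s = [:: l_1; ...; l_L]], the product
   P_{A^(l_1)|A^(k)} ... P_{A^(l_L)|A^(l_(L-1))} E[f|A^(l_L)]. *)
Fixpoint chain_mean (f : X -> R) (k : nat) (s : seq nat) : 'cV[R]_(m k) :=
  match s with
  | [::] => cond_mean_col f k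
  | l :: s' => trans_mx l k *m chain_mean f l s'
  end.

(* The inner sum is over k < l_1 < ... < l_L <= N. *)
Definition Phi (N k : nat) (f : X -> R) : 'cV[R]_(m k) :=
  cond_mean_col f k +
  \sum_(1 <= L < (N - k).+1)
    \sum_(l : L.-tuple 'I_N.+1 | path ltn k (map val l))
      (-1) ^+ L *: chain_mean f k (map val l).

End Raking.

(* Main.v *)
(** For functions of finite second moment under P, the identity
    P(fg) - P(f)P(g) = Cov_P(f, g) says that the bridge G is an isometry
    between covariances. By linearity G^(N) f is, as a finite combination of
    values of G, the image of T_N f = (1 - Pi_1) ... (1 - Pi_N) f, where Pi_k f
    is the conditional expectation of f given the k-th partition. Since Pi_k is
    an orthogonal projection, peeling off the factors of T_N one by one gives
    Cov(T_N f, T_N g) = Cov(f, g) - sum_k Cov(Pi_k h_k(f), Pi_k h_k(g)) with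
    h_k = (1 - Pi_(k+1)) ... (1 - Pi_N), and expanding h_k shows that the values
    of Pi_k h_k(f) on the cells are the entries of Phi_k^(N) f. *)

Require Import Defs.
From HB Require Import structures.
From mathcomp Require Import all_boot all_order all_algebra.
From mathcomp Require Import all_classical all_reals all_analysis.
From mathcomp Require Import measurable_realfun.
From mathcomp Require Import zify.

Import Order.TTheory GRing.Theory Num.Theory.
Import numFieldNormedType.Exports.

Local Open Scope classical_set_scope.
Local Open Scope ring_scope.

Set Implicit Arguments.
Unset Strict Implicit.

(** * Square-integrable functions and real-valued covariances *)

Section SquareIntegrable.
Context {d : measure_display} {T : measurableType d} {R : realType}.
Variable Q : probability T R.
Implicit Types f g h : T -> R.

Lemma Lfun2I f : measurable_fun setT f ->
  (\int[Q]_x ((f x) ^+ 2)%:E < +oo)%E -> f \in Lfun Q 2%:E.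
Proof.
move=> mf If; rewrite inE; apply/andP; split; rewrite inE//=.
rewrite /finite_norm unlock /Lnorm poweR_lty//.
rewrite (eq_integral (fun x => (f x ^+ 2)%:E))// => x _ /=.
by rewrite powR_mulrn// real_normK// num_real.
Qed.

Lemma bounded_Lfun2 f (M : R) : measurable_fun setT f ->
  (forall x, `|f x| <= M) -> f \in Lfun Q 2%:E.
Proof.
move=> mf fM; apply: Lfun2I => //.
have mf2 : measurable_fun setT (fun x => f x ^+ 2) by exact: measurable_funX.
suff /integrableP[_]: Q.-integrable setT (EFin \o (fun x => f x ^+ 2)).
  apply: le_lt_trans; apply: ge0_le_integral => //.
  - by move=> x _; rewrite lee_fin sqr_ge0.
  - exact/measurable_EFinP.
  - by apply: measurableT_comp => //; exact/measurable_EFinP.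
  - by move=> x _; rewrite lee_fin ler_norm.
apply: measurable_bounded_integrable => //.
  by rewrite -ge0_fin_numE// fin_num_measure.
exists (M ^+ 2); split; first by rewrite num_real.
move=> y My x _ /=; apply/ltW/(le_lt_trans _ My).
by rewrite normrX lerXn2r// nnegrE// (le_trans _ (fM x)).
Qed.

Lemma Lfun2_indic (B : set T) : measurable B -> \1_B \in Lfun Q 2%:E.
Proof.
move=> mB; apply: (@bounded_Lfun2 _ 1); first exact: measurable_indic.
by move=> x; rewrite indicE; case: (x \in B); rewrite ?normr1 ?normr0.
Qed.

Lemma Lfun2_1 f : f \in Lfun Q 2%:E -> f \in Lfun Q 1.
Proof. by apply: Lfun_subset12; exact: fin_num_measure. Qed.

Lemma Lfun2_mul_Rintegrable f g : f \in Lfun Q 2%:E -> g \in Lfun Q 2%:E ->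
  Q.-integrable setT (EFin \o (fun x => f x * g x)).
Proof. by move=> f2 g2; apply/Lfun1_integrable/Lfun2_mul_Lfun1. Qed.

Lemma covariance_fin2 f g : f \in Lfun Q 2%:E -> g \in Lfun Q 2%:E ->
  covariance Q f g = (fine (covariance Q f g))%:E.
Proof.
move=> f2 g2; rewrite fineK// covariance_fin_num//; [exact: Lfun2_1.. |].
exact: Lfun2_mul_Lfun1.
Qed.

(** The right-hand side is the covariance kernel of the Brownian bridge, so bridge covariances can
    be read as covariances of functions. Square integrability makes every term finite, so [fine]
    commutes with the operations. *)
Lemma fine_covarianceE f g : f \in Lfun Q 2%:E -> g \in Lfun Q 2%:E ->
  fine (covariance Q f g) =
  (\int[Q]_x (f x * g x)) - (\int[Q]_x f x) * (\int[Q]_x g x).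
Proof.
move=> f2 g2; have fg1 : f \* g \in Lfun Q 1 by exact: Lfun2_mul_Lfun1.
rewrite covarianceE//; [|exact: Lfun2_1..].
have Ef : ('E_Q[f] \is a fin_num)%E
  by apply: expectation_fin_num; exact: Lfun2_1.
have Eg : ('E_Q[g] \is a fin_num)%E
  by apply: expectation_fin_num; exact: Lfun2_1.
have Efg : ('E_Q[f * g] \is a fin_num)%E by exact: expectation_fin_num.
rewrite fineB// ?fin_numM// fineM//.
by rewrite unlock.
Qed.

Lemma fine_covarianceC f g : fine (covariance Q f g) = fine (covariance Q g f).
Proof. by rewrite covarianceC. Qed.

Lemma fine_covarianceBl f g h : f \in Lfun Q 2%:E -> g \in Lfun Q 2%:E ->
  h \in Lfun Q 2%:E -> fine (covariance Q (fun x => f x - g x) h) =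
  fine (covariance Q f h) - fine (covariance Q g h).
Proof.
by move=> f2 g2 h2; rewrite covarianceBl// covariance_fin2// (covariance_fin2 g2).
Qed.

Lemma fine_covarianceBr f g h : f \in Lfun Q 2%:E -> g \in Lfun Q 2%:E ->
  h \in Lfun Q 2%:E -> fine (covariance Q h (fun x => f x - g x)) =
  fine (covariance Q h f) - fine (covariance Q h g).
Proof. by move=> *; rewrite !(fine_covarianceC h) fine_covarianceBl. Qed.

Lemma Lfun2_mul_cst f c : f \in Lfun Q 2%:E ->
  (fun x => c * f x) \in Lfun Q 2%:E.
Proof.
by move=> f2; rewrite -[X in X \in _]/(c *: f) rpredZ//= lee1n.
Qed.

Lemma Lfun2D f g : f \in Lfun Q 2%:E -> g \in Lfun Q 2%:E ->
  (fun x => f x + g x) \in Lfun Q 2%:E.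
Proof.
by move=> f2 g2; rewrite -[X in X \in _]/(f + g) rpredD//= lee1n.
Qed.

End SquareIntegrable.

(** * Formal linear combinations of values of a process *)

Section LinearCombinations.
Context {X T : Type} {R : realType}.
Implicit Types (s : seq (R * (X -> R))) (G : (X -> R) -> T -> R).

(** The coefficients are separate from the process, so that one list [s] can be read both at a
    bridge and, with [G := id], as a function on the base space. *)
Definition lincomb G s : T -> R := fun w => \sum_(p <- s) p.1 * G p.2 w.

Lemma lincomb_nil G : lincomb G [::] = cst 0.
Proof. by apply/funext => w; rewrite /lincomb big_nil. Qed.

Lemma lincomb_cons G p s :
  lincomb G (p :: s) = (fun w => p.1 * G p.2 w + lincomb G s w).
Proof. by apply/funext => w; rewrite /lincomb big_cons. Qed.

Lemma lincomb_cat G s t :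
  lincomb G (s ++ t) = (fun w => lincomb G s w + lincomb G t w).
Proof. by apply/funext => w; rewrite /lincomb big_cat. Qed.

Definition scale_coefs (c : R) s : seq (R * (X -> R)) :=
  [seq (c * p.1, p.2) | p <- s].

Lemma lincomb_scale G c s :
  lincomb G (scale_coefs c s) = (fun w => c * lincomb G s w).
Proof.
apply/funext => w; rewrite /lincomb big_map mulr_sumr.
by apply: eq_bigr => p _ /=; rewrite mulrA.
Qed.

Lemma mem_scale_coefs c s p :
  p \in scale_coefs c s -> exists2 q, q \in s & q.2 = p.2.
Proof. by move=> /mapP[q qs ->]; exists q. Qed.

End LinearCombinations.

(** * Bilinearity of the covariance *)

Section CovarianceLinearCombinations.
Context {d : measure_display} {T : measurableType d} {R : realType} {X : Type}.
Variables (Q : probability T R) (G : (X -> R) -> T -> R).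
Implicit Types s t : seq (R * (X -> R)).

Lemma lincomb_Lfun2 s : {in s, forall p, G p.2 \in Lfun Q 2%:E} ->
  lincomb G s \in Lfun Q 2%:E.
Proof.
elim: s => [_|p s IH ps]; first by rewrite lincomb_nil; exact: Lfun_cst.
rewrite lincomb_cons; apply: Lfun2D.
  by apply/Lfun2_mul_cst/ps; exact: mem_head.
by apply: IH => q qs; apply: ps; rewrite inE qs orbT.
Qed.

Lemma fine_covariance_lincombl s h : {in s, forall p, G p.2 \in Lfun Q 2%:E} ->
  h \in Lfun Q 2%:E ->
  fine (covariance Q (lincomb G s) h) =
  \sum_(p <- s) p.1 * fine (covariance Q (G p.2) h).
Proof.
move=> + h2; elim: s => [_|p s IH ps].
  by rewrite lincomb_nil big_nil covariance_cst_l.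
have p2 : G p.2 \in Lfun Q 2%:E by apply: ps; exact: mem_head.
have s2 : {in s, forall p, G p.2 \in Lfun Q 2%:E}.
  by move=> q qs; apply: ps; rewrite inE qs orbT.
have pZ : covariance Q (fun w => p.1 * G p.2 w) h =
    (p.1 * fine (covariance Q (G p.2) h))%:E.
  rewrite EFinM -covariance_fin2// -covarianceZl//; [|exact: Lfun2_1..|].
    by congr covariance; apply/funext => w /=; rewrite mulrC.
  exact: Lfun2_mul_Lfun1.
rewrite big_cons lincomb_cons -IH// covarianceDl//.
- by rewrite pZ (covariance_fin2 (lincomb_Lfun2 s2) h2).
- exact: Lfun2_mul_cst.
- exact: lincomb_Lfun2.
Qed.

Lemma expectation_lincomb s : {in s, forall p, G p.2 \in Lfun Q 2%:E} ->
  {in s, forall p, ('E_Q[G p.2] = 0)%E} -> ('E_Q[lincomb G s] = 0)%E.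
Proof.
elim: s => [_ _|p s IH ps p0]; first by rewrite lincomb_nil expectation_cst.
have p2 : G p.2 \in Lfun Q 2%:E by apply: ps; exact: mem_head.
have s2 : {in s, forall p, G p.2 \in Lfun Q 2%:E}.
  by move=> q qs; apply: ps; rewrite inE qs orbT.
rewrite lincomb_cons expectationD.
- rewrite IH//; last by move=> q qs; apply: p0; rewrite inE qs orbT.
  rewrite [X in ('E_Q[X])%E](_ : _ = p.1 \o* G p.2); last first.
    by apply/funext => w /=; rewrite mulrC.
  by rewrite expectationZl ?Lfun2_1// p0 ?mem_head// mule0 adde0.
- exact/Lfun2_1/Lfun2_mul_cst.
- exact/Lfun2_1/lincomb_Lfun2.
Qed.

End CovarianceLinearCombinations.

(** Bilinearity reduces both sides to the same weighted sum of covariances of pairs from [F]. *)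
Lemma covariance_isometry {d d' : measure_display} {T : measurableType d}
    {Om : measurableType d'} {R : realType} (P : probability T R)
    (Pr : probability Om R) (F : set (T -> R)) (G : (T -> R) -> Om -> R)
    (s t : seq (R * (T -> R))) :
  (forall f, F f -> f \in Lfun P 2%:E) ->
  (forall f, F f -> G f \in Lfun Pr 2%:E) ->
  (forall f g, F f -> F g -> covariance Pr (G f) (G g) = covariance P f g) ->
  {in s, forall p, F p.2} -> {in t, forall p, F p.2} ->
  covariance Pr (lincomb G s) (lincomb G t) =
  covariance P (lincomb id s) (lincomb id t).
Proof.
move=> F2 G2 GF sF tF.
have sG : {in s, forall p, G p.2 \in Lfun Pr 2%:E} by move=> p /sF/G2.
have tG : {in t, forall p, G p.2 \in Lfun Pr 2%:E} by move=> p /tF/G2.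
have s2 : {in s, forall p, id p.2 \in Lfun P 2%:E} by move=> p /sF/F2.
have t2 : {in t, forall p, id p.2 \in Lfun P 2%:E} by move=> p /tF/F2.
rewrite covariance_fin2 ?lincomb_Lfun2// [RHS]covariance_fin2 ?lincomb_Lfun2//.
congr EFin; rewrite !fine_covariance_lincombl// ?lincomb_Lfun2//.
apply: eq_big_seq => p ps; congr (_ * _).
rewrite 2!(fine_covarianceC _ _ (lincomb _ _)) !fine_covariance_lincombl//.
- by apply: eq_big_seq => q qt; rewrite GF//; [exact: tF|exact: sF].
- exact: s2.
- exact: sG.
Qed.

(** * Linearity of the raking step and of [Phi] *)

Section RakingLinearity.
Context {d : measure_display} {X : measurableType d} {R : realType}.
Variables (P : probability X R) (m : nat -> nat).
Variable A : forall k, 'I_(m k) -> set X.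
Implicit Types (s : seq (R * (X -> R))) (F : set (X -> R)).

(* A linear functional [H] of a process that only involves members of [F],
   given by coefficients that do not depend on the process. *)
Definition spanned F (H : forall T : Type, ((X -> R) -> T -> R) -> T -> R) :=
  exists2 s, {in s, forall p, F p.2} & forall T G, H T G = lincomb G s.

Lemma spanned_eval F f : F f -> spanned F (fun T G => G f).
Proof.
move=> Ff; exists [:: (1, f)]; first by move=> p; rewrite inE => /eqP ->.
move=> T G; apply/funext => w.
by rewrite lincomb_cons lincomb_nil mul1r addr0.
Qed.

Lemma spannedB F H1 H2 : spanned F H1 -> spanned F H2 ->
  spanned F (fun T G w => H1 T G w - H2 T G w).
Proof.
move=> [s sF H1E] [t tF H2E]; exists (s ++ scale_coefs (-1) t).
  move=> p; rewrite mem_cat => /orP[/sF//|/mem_scale_coefs[q /tF Fq <-//]].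
by move=> T G; rewrite lincomb_cat lincomb_scale H1E H2E; apply/funext => w;
  rewrite mulN1r.
Qed.

Lemma spanned_sum F {I : Type} (r : seq I) (c : I -> R) H :
  (forall i, spanned F (H i)) ->
  spanned F (fun T G w => \sum_(i <- r) c i * H i T G w).
Proof.
move=> FH; elim: r => [|i r [t tF HE]].
  by exists [::] => // T G; rewrite lincomb_nil; apply/funext => w; rewrite big_nil.
have [s sF HiE] := FH i; exists (scale_coefs (c i) s ++ t).
  move=> p; rewrite mem_cat => /orP[/mem_scale_coefs[q /sF Fq <-//]|/tF//].
move=> T G; rewrite lincomb_cat lincomb_scale -HE -HiE; apply/funext => w.
by rewrite big_cons.
Qed.

(** Each raking step evaluates the previous process at [f] and at indicators of cells, which closure
    under cells keeps in [F]. The coefficients are conditional means under [P], whatever the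
    process. *)
Lemma raked_spanned F N n f : closed_under_cells A F N -> (n <= N)%N -> F f ->
  spanned F (fun T G => raked P A G n f).
Proof.
move=> FA; elim: n f => [|n IH] f nN Ff; first exact: spanned_eval.
apply: spannedB; first by apply: IH => //; exact: ltnW.
apply: spanned_sum => j; apply: IH; first exact: ltnW.
by have [] := FA n.+1 nN j.
Qed.

Lemma Rintegral_lincomb_mul s h : {in s, forall p, p.2 \in Lfun P 2%:E} ->
  h \in Lfun P 2%:E ->
  \int[P]_x (lincomb id s x * h x) = \sum_(p <- s) p.1 * \int[P]_x (p.2 x * h x).
Proof.
move=> + h2; elim: s => [_|p s IH ps].
  rewrite lincomb_nil big_nil; under eq_Rintegral do rewrite mul0r.
  by rewrite Rintegral_cst// mul0r.
have p2 : p.2 \in Lfun P 2%:E by apply: ps; exact: mem_head.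
have s2 : {in s, forall p, p.2 \in Lfun P 2%:E}.
  by move=> q qs; apply: ps; rewrite inE qs orbT.
rewrite big_cons -IH// -RintegralZl//; last exact: Lfun2_mul_Rintegrable.
rewrite lincomb_cons -RintegralD//.
- by apply: eq_Rintegral => x _; rewrite mulrDl mulrA.
- under eq_fun do rewrite mulrA.
  by apply: Lfun2_mul_Rintegrable => //; exact: Lfun2_mul_cst.
- by apply: Lfun2_mul_Rintegrable => //; exact: lincomb_Lfun2.
Qed.

Lemma cond_mean_lincomb s B : {in s, forall p, p.2 \in Lfun P 2%:E} ->
  measurable B ->
  cond_mean P (lincomb id s) B = \sum_(p <- s) p.1 * cond_mean P p.2 B.
Proof.
move=> s2 mB; rewrite /cond_mean Rintegral_lincomb_mul//; last first.
  exact: Lfun2_indic.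
by rewrite mulr_suml; apply: eq_bigr => p _; rewrite mulrA.
Qed.

Hypothesis mA : forall k, (1 <= k)%N -> forall j, measurable (@A k j).

(** Conditional means are linear in the function, so linearity at stage 0 passes to every stage. It
    is assumed at one point [w] and for one combination only: this is automatic for [id], and holds
    for the bridge off a single null set. *)
Lemma raked_lincomb {T : Type} (G : (X -> R) -> T -> R) n s w :
  {in s, forall p, p.2 \in Lfun P 2%:E} ->
  G (lincomb id s) w = lincomb G s w ->
  raked P A G n (lincomb id s) w = lincomb (raked P A G n) s w.
Proof.
move=> s2 Gs; elim: n => //= n ->.
under eq_bigr => j _ do
  rewrite (cond_mean_lincomb s2 (mA (ltn0Sn n) j)) mulr_suml.
rewrite exchange_big /lincomb -sumrB; apply: eq_bigr => p _ /=.
rewrite mulrBr mulr_sumr; congr (_ - _); apply: eq_bigr => j _.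
by rewrite -mulrA.
Qed.

Lemma cond_mean_col_lincomb s k : (1 <= k)%N ->
  {in s, forall p, p.2 \in Lfun P 2%:E} ->
  cond_mean_col P A (lincomb id s) k =
  \sum_(p <- s) p.1 *: cond_mean_col P A p.2 k.
Proof.
move=> k0 s2; apply/colP => j; rewrite summxE mxE (cond_mean_lincomb s2 (mA k0 j)).
by apply: eq_bigr => p _; rewrite !mxE.
Qed.

Lemma chain_mean_lincomb s k l : (1 <= k)%N -> path ltn k l ->
  {in s, forall p, p.2 \in Lfun P 2%:E} ->
  chain_mean P A (lincomb id s) k l =
  \sum_(p <- s) p.1 *: chain_mean P A p.2 k l.
Proof.
move=> + + s2; elim: l k => [|i l IH] k k0 /=.
  by move=> _; exact: cond_mean_col_lincomb.
move=> /andP[ki il]; rewrite IH//; last exact: leq_trans ki.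
by rewrite mulmx_sumr; apply: eq_bigr => p _; rewrite scalemxAr.
Qed.

Lemma Phi_lincomb s N k : (1 <= k)%N ->
  {in s, forall p, p.2 \in Lfun P 2%:E} ->
  Phi P A N k (lincomb id s) = \sum_(p <- s) p.1 *: Phi P A N k p.2.
Proof.
move=> k0 s2; rewrite /Phi cond_mean_col_lincomb//.
under [in RHS]eq_bigr do rewrite scalerDr.
rewrite big_split; congr (_ + _) => /=.
under [in RHS]eq_bigr do rewrite scaler_sumr.
rewrite [in RHS]exchange_big; apply: eq_bigr => L _ /=.
under [in RHS]eq_bigr do rewrite scaler_sumr.
rewrite [in RHS]exchange_big; apply: eq_bigr => l kl /=.
rewrite chain_mean_lincomb// scaler_sumr; apply: eq_bigr => p _.
by rewrite !scalerA mulrC.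
Qed.

End RakingLinearity.

(** * Recursion of [Phi] in the number of partitions *)

Section PhiRecursion.
Context {d : measure_display} {X : measurableType d} {R : realType}.
Variables (P : probability X R) (m : nat -> nat).
Variable A : forall k, 'I_(m k) -> set X.
Implicit Types (f : X -> R) (N L k : nat).

(** The unsigned part of [Phi] with chains of length [L]. Allowing [L = 0] absorbs the leading
    conditional mean of [Phi]. *)
Definition chain_sum N L k f : 'cV[R]_(m k) :=
  \sum_(l : L.-tuple 'I_N.+1 | path ltn k (map val l))
    chain_mean P A f k (map val l).

Lemma chain_sum0 N k f : chain_sum N 0 k f = cond_mean_col P A f k.
Proof.
rewrite /chain_sum (big_pred1 [tuple]) ?mulr0//= => l.
by rewrite [l]tuple0; symmetry; apply/eqP.
Qed.

(** A nonempty chain is its first index [i] followed by a chain starting from [i]. *)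
Lemma chain_sumS N L k f : chain_sum N L.+1 k f =
  \sum_(i < N.+1 | (k < i)%N) trans_mx P A i k *m chain_sum N L i f.
Proof.
under eq_bigr do rewrite mulmx_sumr.
rewrite pair_big_dep /chain_sum /=.
rewrite (reindex (fun p : 'I_N.+1 * L.-tuple 'I_N.+1 => [tuple of p.1 :: p.2])) //=.
exists (fun l => (thead l, [tuple of behead l])) => [[i l] _ | l _] /=.
  by congr (_, _); apply/val_inj.
by apply/val_inj; exact: esym (congr1 val (tuple_eta l)).
Qed.

(** A strictly increasing chain of [L] indices above [k] ends at [k + L] or later, beyond [N], so
    the sum is empty. *)
Lemma chain_sum_gt N L k f : (0 < L)%N -> (N < k + L)%N ->
  chain_sum N L k f = 0.
Proof.
elim: L k => // L IH k _ NkL; rewrite chain_sumS big1// => i ki.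
have iN := ltn_ord i.
have L0 : (0 < L)%N by rewrite lt0n; apply/eqP => L0; rewrite L0 addn1 in NkL; lia.
by rewrite IH ?mulmx0//; lia.
Qed.

Lemma chain_sumS_recr N L k f : (k <= N)%N -> chain_sum N.+1 L.+1 k f =
  \sum_(i < N.+1 | (k < i)%N) trans_mx P A i k *m chain_sum N.+1 L i f +
  trans_mx P A N.+1 k *m chain_sum N.+1 L N.+1 f.
Proof.
move=> kN; rewrite chain_sumS big_mkcond big_ord_recr /= ltnS kN.
by rewrite -big_mkcond.
Qed.

(** Chains too long to fit contribute nothing, so the bound [M] is free; this lets [Phi] at [N] and
    at [N.+1] be compared over a common range. *)
Lemma PhiE N M k f : (k <= N)%N -> (N - k < M)%N ->
  Phi P A N k f = \sum_(0 <= L < M) (-1) ^+ L *: chain_sum N L k f.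
Proof.
move=> kN NM; rewrite (big_cat_nat (n := (N - k).+1))//=.
rewrite [X in _ + X]big1_seq ?addr0; last first.
  move=> L /=; rewrite mem_index_iota => /andP[LNk _].
  by rewrite chain_sum_gt ?scaler0//; lia.
rewrite big_ltn// chain_sum0 scale1r; congr (_ + _).
by apply: eq_bigr => L _; rewrite scaler_sumr.
Qed.

Lemma Phi_diag N f : Phi P A N N f = cond_mean_col P A f N.
Proof. by rewrite (@PhiE _ 1) ?subnn// big_nat1 chain_sum0 scale1r. Qed.

Hypothesis mA : forall k, (1 <= k)%N -> forall j, measurable (@A k j).

Lemma cond_mean_indic (B C : set X) : measurable B -> measurable C ->
  cond_mean P \1_B C = fine (P (B `&` C)) / fine (P C).
Proof.
move=> mB mC; congr (_ / _).
rewrite -[X in Rintegral _ _ X]/(\1_B \* \1_C) -indicI /Rintegral.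
by rewrite integral_indic ?setIT//; exact: measurableI.
Qed.

(** Column [j] of the transition matrix consists of the conditional means of the indicator of the
    [j]-th cell. *)
Lemma trans_mx_cond_mean N k f : (1 <= k)%N ->
  trans_mx P A N.+1 k *m cond_mean_col P A f N.+1 =
  \sum_j cond_mean P f (@A N.+1 j) *: cond_mean_col P A \1_(@A N.+1 j) k.
Proof.
move=> k0; apply/colP => i; rewrite !mxE summxE; apply: eq_bigr => j _.
by rewrite !mxE (cond_mean_indic (mA (ltn0Sn N) j) (mA k0 i)) [LHS]mulrC.
Qed.

(* A chain in [k+1, N+1] either avoids N+1 or ends with it; in the latter case
   the last factor contributes the values of f on the cells of A^(N+1). *)
Lemma chain_sum_recr N L k f : (1 <= k <= N)%N ->
  chain_sum N.+1 L.+1 k f = chain_sum N L.+1 k f +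
  \sum_j cond_mean P f (@A N.+1 j) *: chain_sum N L k \1_(@A N.+1 j).
Proof.
elim: L k => [|L IH] k /andP[k0 kN].
  rewrite chain_sumS_recr// chain_sumS chain_sum0 trans_mx_cond_mean//.
  by congr (_ + _); apply: eq_bigr => i _; rewrite !chain_sum0.
(* The term [i = N.+1] vanishes: a nonempty chain cannot continue past [N.+1]. *)
rewrite chain_sumS_recr// chain_sum_gt//; last by lia.
rewrite mulmx0 addr0 chain_sumS.
under [in LHS]eq_bigr => i ki.
  rewrite IH; last by rewrite (leq_trans k0 (ltnW ki)) -ltnS ltn_ord.
  rewrite mulmxDr; over.
rewrite big_split /=; congr (_ + _).
under eq_bigr do rewrite mulmx_sumr.
rewrite exchange_big /=; apply: eq_bigr => j _.
rewrite chain_sumS scaler_sumr; apply: eq_bigr => i _.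
by rewrite scalemxAr.
Qed.

(** This is the recursion that defines the raked process. Removing a final index [N.+1] shortens a
    chain by one, which produces the minus sign. *)
Lemma Phi_recr N k f : (1 <= k <= N)%N ->
  Phi P A N.+1 k f = Phi P A N k f -
  \sum_j cond_mean P f (@A N.+1 j) *: Phi P A N k \1_(@A N.+1 j).
Proof.
move=> /andP[k0 kN].
rewrite (@PhiE _ (N - k).+2); [|lia..].
rewrite (@PhiE _ (N - k).+2 k f)//.
rewrite 2!(big_nat_recl (N - k).+1 0 _ (leq0n _)) /= !chain_sum0 -addrA; congr (_ + _).
under eq_bigr do rewrite chain_sum_recr ?k0// scalerDr.
rewrite big_split /=; congr (_ + _).
under [in RHS]eq_bigr do rewrite (@PhiE _ (N - k).+1)// scaler_sumr.
rewrite exchange_big -sumrN; apply: eq_bigr => L _ /=.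
rewrite scaler_sumr -sumrN; apply: eq_bigr => j _.
by rewrite exprS mulN1r scaleNr !scalerA mulrC.
Qed.

End PhiRecursion.

(** * Conditional expectation as an orthogonal projection *)

Section Pythagoras.
Context {d : measure_display} {X : measurableType d} {R : realType}.
Variables (P : probability X R) (m : nat -> nat).
Variable A : forall k, 'I_(m k) -> set X.
Hypothesis hA : partition_sequence P A.
Implicit Types f g : X -> R.

Let mA k : (1 <= k)%N -> forall j, measurable (@A k j).
Proof. by case: hA => _ _ + _ _; apply. Qed.

Let cov f g := fine (covariance P f g).

(** Coefficients of Pi_k f on the cells. [cond_proj] is Pi_k and [residual] is 1 - Pi_k; both are
    kept as formal combinations so that the linearity lemmas apply. *)
Definition proj_coefs k f : seq (R * (X -> R)) :=
  [seq (cond_mean P f (@A k j), \1_(@A k j) : X -> R) | j : 'I_(m k)].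

Definition residual_coefs k f := (1, f) :: scale_coefs (-1) (proj_coefs k f).

Definition cond_proj k f := lincomb id (proj_coefs k f).

Definition residual k f := lincomb id (residual_coefs k f).

Lemma proj_coefs_Lfun2 k f : (1 <= k)%N ->
  {in proj_coefs k f, forall p, p.2 \in Lfun P 2%:E}.
Proof. by move=> k0 p /mapP[j _ ->]; exact/Lfun2_indic/mA. Qed.

Lemma residual_coefs_Lfun2 k f : (1 <= k)%N -> f \in Lfun P 2%:E ->
  {in residual_coefs k f, forall p, p.2 \in Lfun P 2%:E}.
Proof.
move=> k0 f2 p; rewrite inE => /predU1P[-> //|/mem_scale_coefs[q qf <-]].
exact: proj_coefs_Lfun2 qf.
Qed.

Lemma cond_proj_Lfun2 k f : (1 <= k)%N -> cond_proj k f \in Lfun P 2%:E.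
Proof. by move=> k0; exact/lincomb_Lfun2/proj_coefs_Lfun2. Qed.

Lemma residual_Lfun2 k f : (1 <= k)%N -> f \in Lfun P 2%:E ->
  residual k f \in Lfun P 2%:E.
Proof. by move=> k0 f2; exact/lincomb_Lfun2/residual_coefs_Lfun2. Qed.

Lemma residualE k f : residual k f = (fun x => f x - cond_proj k f x).
Proof.
apply/funext => x; rewrite /residual lincomb_cons lincomb_scale.
by rewrite mul1r mulN1r.
Qed.

Lemma big_proj_coefs (V : zmodType) k f (H : R * (X -> R) -> V) :
  \sum_(p <- proj_coefs k f) H p =
  \sum_j H (cond_mean P f (@A k j), \1_(@A k j) : X -> R).
Proof. by rewrite /proj_coefs big_image. Qed.

Lemma cell_inj k i j x : (1 <= k)%N -> @A k i x -> @A k j x -> i = j.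
Proof.
by move=> k0 xi xj; have [_ /(_ _ k0)[_ + _] _ _ _] := hA; apply => //; exists x.
Qed.

Lemma Rintegral_indic_mul k i j : (1 <= k)%N ->
  \int[P]_x (\1_(@A k i) x * \1_(@A k j) x) =
  (i == j)%:R * fine (P (@A k j)) :> R.
Proof.
move=> k0; have [-> |ij] := eqVneq i j.
  under eq_Rintegral => x _.
    rewrite !indicE -natrM mulnb andbb -indicE; over.
  by rewrite mul1r /Rintegral integral_indic ?setIT//; exact: mA.
rewrite mul0r; under eq_Rintegral => x _.
  rewrite (_ : _ * _ = 0); first over.
  rewrite !indicE -natrM mulnb; case: andP => // -[].
  by rewrite !inE => xi xj; rewrite (cell_inj k0 xi xj) eqxx in ij.
by rewrite Rintegral_cst// mul0r.
Qed.

(** By disjointness only the [j]-th coefficient of the projection survives, and it contributes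
    exactly the integral of [f] over that cell. *)
Lemma Rintegral_residual_mul k f j : (1 <= k)%N -> f \in Lfun P 2%:E ->
  \int[P]_x (residual k f x * \1_(@A k j) x) = 0.
Proof.
move=> k0 f2; have j2 : \1_(@A k j) \in Lfun P 2%:E by exact/Lfun2_indic/mA.
rewrite residualE; under eq_Rintegral do rewrite mulrBl.
rewrite RintegralB//.
- rewrite Rintegral_lincomb_mul//; last exact: proj_coefs_Lfun2.
  rewrite big_proj_coefs (bigD1 j)//= big1 ?addr0 => [|i ij].
    rewrite Rintegral_indic_mul// eqxx mul1r divfK ?subrr//.
    (* Cells have positive mass, so the division in [cond_mean] cancels. *)
    rewrite gt_eqF// fine_gt0// ltey_eq fin_num_measure//; last exact: mA.
    by case: hA => _ _ _ + _; rewrite andbT; apply.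
  by rewrite Rintegral_indic_mul// (negbTE ij) mul0r mulr0.
- exact: Lfun2_mul_Rintegrable.
- by apply: Lfun2_mul_Rintegrable => //; exact: cond_proj_Lfun2.
Qed.

Lemma sum_indic_cells k x : (1 <= k)%N -> \sum_j \1_(@A k j) x = 1 :> R.
Proof.
move=> k0; have [_ /(_ _ k0)[cA _ _] _ _ _] := hA.
have [j _ xj] : cover setT (@A k) x by rewrite cA.
rewrite (bigD1 j)//= indicE mem_set// big1 ?addr0// => i ij.
rewrite indicE memNset// => xi.
by rewrite (cell_inj k0 xi xj) eqxx in ij.
Qed.

(** The constant 1 is the sum of the cell indicators, and the residual is orthogonal to each of
    them. *)
Lemma Rintegral_residual k f : (1 <= k)%N -> f \in Lfun P 2%:E ->
  \int[P]_x residual k f x = 0.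
Proof.
move=> k0 f2.
have := @Rintegral_lincomb_mul _ _ _ P
  [seq (1, \1_(@A k j) : X -> R) | j : 'I_(m k)] (residual k f).
under eq_Rintegral => x _.
  rewrite /lincomb big_image /=.
  under eq_bigr do rewrite mul1r.
  rewrite sum_indic_cells// mul1r; over.
rewrite big_image /= => ->.
- rewrite big1// => j _; rewrite mul1r -[RHS](@Rintegral_residual_mul k f j)//.
  by apply: eq_Rintegral => x _; rewrite mulrC.
- by move=> p /mapP[j _ ->]; exact/Lfun2_indic/mA.
- exact: residual_Lfun2.
Qed.

Lemma cov_residual_proj k f g : (1 <= k)%N -> f \in Lfun P 2%:E ->
  cov (residual k f) (cond_proj k g) = 0.
Proof.
move=> k0 f2; rewrite /cov fine_covarianceC fine_covariance_lincombl.
- rewrite big_proj_coefs big1// => j _ /=.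
  rewrite fine_covarianceC fine_covarianceE; [|exact: residual_Lfun2|].
    by rewrite Rintegral_residual_mul// Rintegral_residual// mul0r subrr mulr0.
  exact/Lfun2_indic/mA.
- exact: proj_coefs_Lfun2.
- exact: residual_Lfun2.
Qed.

(** Bilinear expansion over the cells. Here [cell_cov] is taken at the process [id], giving the
    covariance matrix of the cell indicators under [P]. *)
Lemma cov_proj k f g : (1 <= k)%N ->
  cov (cond_proj k f) (cond_proj k g) =
  ((cond_mean_col P A f k)^T *m cell_cov A P id k *m cond_mean_col P A g k) 0 0.
Proof.
move=> k0; have p2 h := @proj_coefs_Lfun2 k h k0.
rewrite /cov fine_covariance_lincombl ?cond_proj_Lfun2//.
rewrite big_proj_coefs -mulmxA !mxE; apply: eq_bigr => i _ /=.
rewrite !mxE; congr (_ * _).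
rewrite fine_covarianceC fine_covariance_lincombl//; last first.
  exact/Lfun2_indic/mA.
rewrite big_proj_coefs; apply: eq_bigr => j _ /=.
by rewrite !mxE mulrC fine_covarianceC.
Qed.

Lemma cov_residual k f g : (1 <= k)%N -> f \in Lfun P 2%:E ->
  g \in Lfun P 2%:E ->
  cov (residual k f) (residual k g) = cov f g -
  ((cond_mean_col P A f k)^T *m cell_cov A P id k *m cond_mean_col P A g k) 0 0.
Proof.
move=> k0 f2 g2; rewrite -cov_proj//.
have [pf2 pg2] := (cond_proj_Lfun2 f k0, cond_proj_Lfun2 g k0).
have rf2 := residual_Lfun2 k0 f2.
rewrite {1}/cov [X in covariance P _ X]residualE fine_covarianceBr//.
rewrite -!/(cov _ _) cov_residual_proj// subr0 /cov residualE.
rewrite fine_covarianceBl//; congr (_ - _).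
(* Since the residual of [g] is uncorrelated with the projection of [f], that projection has the
   same covariance with [g] as with the projection of [g]. *)
have := cov_residual_proj f k0 g2.
rewrite /cov residualE fine_covarianceBl// => /eqP; rewrite subr_eq0 => /eqP.
by rewrite fine_covarianceC => ->; rewrite fine_covarianceC.
Qed.

(* [raked P A id n f] is the function T_n f = (1 - Pi_1) ... (1 - Pi_n) f. *)
Lemma raked_id_recr n f : f \in Lfun P 2%:E ->
  raked P A id n.+1 f = raked P A id n (residual n.+1 f).
Proof.
move=> f2; apply/funext => x.
rewrite raked_lincomb//; last exact: residual_coefs_Lfun2.
rewrite lincomb_cons mul1r lincomb_scale mulN1r.
by rewrite /lincomb big_proj_coefs.
Qed.

(** Linearity of [Phi] turns the left-hand side into the right-hand side of [Phi_recr]. *)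
Lemma Phi_residual n k f : (1 <= k <= n)%N -> f \in Lfun P 2%:E ->
  Phi P A n k (residual n.+1 f) = Phi P A n.+1 k f.
Proof.
move=> kn f2; have /andP[k0 _] := kn.
rewrite Phi_lincomb//; last exact: residual_coefs_Lfun2.
rewrite Phi_recr// big_cons scale1r big_map big_proj_coefs -sumrN.
by congr (_ + _); apply: eq_bigr => j _; rewrite mulN1r scaleNr.
Qed.

(** Induction with [f] and [g] free, since the hypothesis is applied to their residuals. The new
    term [k = n.+1] comes from [cov_residual], through [Phi_diag]. *)
Lemma cov_raked n f g : f \in Lfun P 2%:E -> g \in Lfun P 2%:E ->
  cov (raked P A id n f) (raked P A id n g) = cov f g -
  \sum_(1 <= k < n.+1)
    ((Phi P A n k f)^T *m cell_cov A P id k *m Phi P A n k g) 0 0.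
Proof.
elim: n f g => [|n IH] f g f2 g2; first by rewrite big_nil subr0.
rewrite !raked_id_recr// IH ?residual_Lfun2// cov_residual//.
rewrite [in RHS]big_nat_recr//= !Phi_diag opprD addrA [LHS]addrAC.
congr (_ - _ - _); apply: eq_big_nat => k kn.
by rewrite !Phi_residual.
Qed.

End Pythagoras.

(** * Square integrability and isometry of the bridge *)

Section GaussianLinearCombinations.
Context {d' : measure_display} {Om : measurableType d'} {R : realType}.
Variable Pr : probability Om R.

Lemma gaussian_lincomb {X : Type} (F : set (X -> R))
    (G : (X -> R) -> Om -> R) (s : seq (R * (X -> R))) :
  gaussian_process Pr F G -> {in s, forall p, F p.2} ->
  gaussian_variable Pr (lincomb G s).
Proof.
move=> gG sF; have := gG (size s) (fun i => (tnth (in_tuple s) i).2)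
  (fun i => (tnth (in_tuple s) i).1) (fun i => sF _ (mem_tnth i (in_tuple s))).
congr gaussian_variable; apply/funext => w.
by rewrite /lincomb [in RHS](big_tnth _ _ s).
Qed.

Context {d : measure_display} {X : measurableType d}.
Variables (P : probability X R) (F : set (X -> R)) (G : (X -> R) -> Om -> R).
Hypothesis GB : brownian_bridge Pr P F G.

(** Measurability comes from the one-term marginal. As [G f] is centered, its second moment is its
    variance, which is finite because the kernel is real-valued. *)
Lemma bridge_Lfun2 f : F f -> G f \in Lfun Pr 2%:E.
Proof.
case: GB => gG cG _ covG Ff; apply: Lfun2I.
  have sF : {in [:: (1, f)], forall p : R * (X -> R), F p.2}.
    by move=> p; rewrite inE => /eqP ->.
  have [+ _] := gaussian_lincomb gG sF.
  rewrite lincomb_cons lincomb_nil; congr measurable_fun.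
  by apply/funext => w; rewrite mul1r addr0.
have := covG f f Ff Ff; rewrite unlock cG// unlock => E.
rewrite [X in (X < _)%E](_ : _ =
  \int[Pr]_w (((G f \- cst (fine 0%E)) * (G f \- cst (fine 0%E))) w)%:E)%E.
  by rewrite E ltry.
by apply: eq_integral => w _; rewrite expr2 !fctE /= subr0.
Qed.

Lemma bridge_isometry f g : f \in Lfun P 2%:E -> g \in Lfun P 2%:E ->
  F f -> F g -> covariance Pr (G f) (G g) = covariance P f g.
Proof.
case: GB => _ _ _ covG f2 g2 Ff Fg.
by rewrite covG// -fine_covarianceE// -covariance_fin2.
Qed.

End GaussianLinearCombinations.

(** * The law of the raked process *)

Unset Implicit Arguments.
Set Strict Implicit.

Theorem proposition7 (R : realType)
  (d : measure_display) (X : measurableType d) (P : probability X R)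
  (m : nat -> nat) (A : forall k : nat, 'I_(m k) -> set X)
  (hA : partition_sequence P A)
  (N : nat)
  (F : set (X -> R))
  (F_meas : forall f, F f -> measurable_fun setT f)
  (F_bounded : uniformly_bounded F)
  (F_pointwise : pointwise_measurable F)
  (F_cells : closed_under_cells A F N)
  (F_entropy : VC_entropy F \/ BR_entropy P F)
  (d' : measure_display) (Om : measurableType d') (Pr : probability Om R)
  (G : (X -> R) -> Om -> R)
  (G_bridge : brownian_bridge Pr P F G) :
  [/\ gaussian_process Pr F (raked P A G N),
      centered_process Pr F (raked P A G N),
      linear_process Pr F (raked P A G N)
    & forall f g, F f -> F g ->
        covariance Pr (raked P A G N f) (raked P A G N g) =
        (covariance Pr (G f) (G g) -
         (\sum_(1 <= k < N.+1)
            ((Phi P A N k f)^T *m cell_cov A Pr G k *m Phi P A N k g) 0 0)%:E)%E].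
Proof.
have F2 f : F f -> f \in Lfun P 2%:E.
  move=> Ff; have [M FM] := F_bounded.
  by apply: (@bounded_Lfun2 _ _ _ _ _ M); [exact: F_meas|exact: FM].
have mA k : (1 <= k)%N -> forall j, measurable (A k j).
  by case: hA => _ _ + _ _; apply.
have G2 f : F f -> G f \in Lfun Pr 2%:E by exact: (bridge_Lfun2 G_bridge).
have [gG cG lG _] := G_bridge.
have span f : F f -> spanned F (fun T G => raked P A G N f).
  by apply: raked_spanned F_cells _.
split.
- move=> n f a Ff.
  (* A combination of raked values is again a combination of values of [G], to which the Gaussian
     property of [G] applies. *)
  suff [s sF HE] : spanned F
      (fun T G w => \sum_(i < n) a i * raked P A G N (f i) w).
    by rewrite (HE _ G); exact: gaussian_lincomb gG sF.
  by apply: (@spanned_sum _ _ _ F) => i; exact: span.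
- move=> f /span[s sF ->].
  by apply: expectation_lincomb => p /sF; [exact: G2|exact: cG].
- move=> n f a Ff Fs.
  pose s := [seq (a i, f i) | i : 'I_n].
  have sE T (H : (X -> R) -> T -> R) :
      lincomb H s = (fun w => \sum_(i < n) a i * H (f i) w).
    by apply/funext => w; rewrite /lincomb /s big_image.
  (* The exceptional null set is the one for this combination under [G]. *)
  have := lG n f a Ff Fs; apply: filterS => w.
  have -> : (fun x => \sum_(i < n) a i * f i x) = lincomb id s by rewrite sE.
  move=> Gw; rewrite raked_lincomb//.
  + by rewrite sE.
  + by move=> p /mapP[i _ ->]; exact/F2/Ff.
  + by rewrite Gw sE.
- move=> f g Ff Fg.
  have [[s sF fE] [t tF gE]] := (span f Ff, span g Fg).
  have iso u v : F u -> F v -> covariance Pr (G u) (G v) = covariance P u v.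
    by move=> Fu Fv; apply: (bridge_isometry G_bridge) => //; exact: F2.
  (* The coefficients serve [G] and [id] alike: expand at [G], pass to [P] by the isometry, and fold
     back at [id], which yields the functions T_N f and T_N g. *)
  rewrite fE gE (covariance_isometry F2 G2 iso sF tF) -fE -gE.
  have rL2 h : F h -> raked P A id N h \in Lfun P 2%:E.
    by move=> /span[u uF ->]; apply: lincomb_Lfun2 => p /uF/F2.
  rewrite covariance_fin2 ?rL2// (cov_raked hA) ?F2// iso// EFinB.
  rewrite -covariance_fin2 ?F2//; congr (_ - _%:E)%E.
  apply: eq_big_nat => k kN; congr ((_ *m _ *m _) 0 0).
  (* For [k <= N] the indicators of cells lie in [F], so the isometry identifies the two cell
     covariance matrices. *)
  have Fk j : F \1_(A k j) by have [] := F_cells k kN j.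
  by apply/matrixP => i j; rewrite !mxE iso.
Qed.
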